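(* Let $G=(V,A)$, the time horizon $\mathcal{T}=[0,T]$, the velocities $v_a(t)$, the mass flows $q_a(t)=A_a\rho v_a(t)$, the arc-end temperatures $T_{a:u}(t)$, the node temperatures $T_u(t)$, and the sets $\mathcal{I}(u,t)$, $\mathcal{O}(u,t)$ be as described in the context, and assume that the mass balance $$\sum_{a\in\delta^{\mathrm{in}}(u)} q_a(t)=\sum_{a\in\delta^{\mathrm{out}}(u)} q_a(t),\qquad u\in V,\ t\in\mathcal{T},$$ holds. Suppose that all nodes have a positive inflow, i.e., $$\sum_{a\in\mathcal{I}(u,t)}|q_a(t)|>0,\qquad u\in V,\ t\in\mathcal{T}.$$ Then the following two systems (M) and (R) are equivalent, i.e., (M) holds if and only if (R) holds. (M) (mixing equations) $$T_u(t)=\frac{\sum_{a\in\mathcal{I}(u,t)}|q_a(t)|\,T_{a:u}(t)}{\sum_{a\in\mathcal{I}(u,t)}|q_a(t)|},\qquad u\in V,\ t\in\mathcal{T},$$ $$T_u(t)=T_{a:u}(t),\qquad u\in V,\ a\in\mathcal{O}(u,t),\ t\in\mathcal{T}.$$ (R) (thermal energy balance and temperature propagation) $$\sum_{a\in\delta^{\mathrm{in}}(u)}q_a(t)\,T_{a:u}(t)=\sum_{a\in\delta^{\mathrm{out}}(u)}q_a(t)\,T_{a:u}(t),\qquad u\in V,\ t\in\mathcal{T},$$ $$v_a(t)\,|T_{a:u}(t)-T_u(t)|\le 0,\qquad u\in V,\ a\in\delta^{\mathrm{out}}(u),\ t\in\mathcal{T},$$ $$v_a(t)\,|T_{a:u}(t)-T_u(t)|\ge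 0,\qquad u\in V,\ a\in\delta^{\mathrm{in}}(u),\ t\in\mathcal{T}.$$
   Context: $G=(V,A)$ is a finite connected directed graph without loops (modeling a district heating network), and $\mathcal{T}=[0,T]$ with $T>0$ is a time horizon. For a node $u\in V$, $\delta^{\mathrm{out}}(u)$ is the set of arcs of the form $(u,w)\in A$, $\delta^{\mathrm{in}}(u)$ is the set of arcs of the form $(w,u)\in A$, and $\delta(u)=\delta^{\mathrm{out}}(u)\cup\delta^{\mathrm{in}}(u)$. For each arc $a\in A$ and $t\in\mathcal{T}$, $v_a(t)\in\mathbb{R}$ is the flow velocity (independent of the position along the arc) and $q_a(t)=A_a\rho v_a(t)$ is the mass flow, where $A_a>0$ is the constant cross-sectional area and $\rho>0$ is the constant water density; in particular $q_a(t)$ and $v_a(t)$ have the same sign. For each $u\in V$, $a\in\delta(u)$ and $t\in\mathcal{T}$, $T_{a:u}(t)\in\mathbb{R}$ denotes the water temperature at the end of arc $a$ located at node $u$ (i.e., $T_a(0,t)$ if $a\in\delta^{\mathrm{out}}(u)$ and $T_a(L_a,t)$ if $a\in\delta^{\mathrm{in}}(u)$, where $T_a(x,t)$ is the temperature in arc $a$ of length $L_a$ at position $x$). $T_u(t)\in\mathbb{R}$ denotes the mixed water temperature at node $u$. The inflow and outflow arcs of node $u$ at time $t$ are $$\mathcal{I}(u,t)=\{a\in\delta^{\mathrm{in}}(u): v_a(t)\ge 0\}\cup\{a\in\delta^{\mathrm{out}}(u): v_a(t)\le 0\},$$ $$\mathcal{O}(u,t)=\{a\in\delta^{\mathrm{in}}(u):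 v_a(t)<0\}\cup\{a\in\delta^{\mathrm{out}}(u): v_a(t)>0\}.$$ *)

(* Defs.v *)
From mathcomp Require Import all_boot all_order all_algebra.
From mathcomp Require Import reals.

Set Implicit Arguments.
Unset Strict Implicit.
Unset Printing Implicit Defensive.

Import Order.TTheory GRing.Theory Num.Theory.
Local Open Scope ring_scope.

(* A directed graph is a finite type of nodes [V] with a set of arcs
   [A : {set V * V}]; the arc [(u, w)] leaves [u] and enters [w]. *)
Section Graph.
Variables (V : finType) (A : {set V * V}).

Definition loopless : Prop := forall a, a \in A -> a.1 != a.2.

Definition weakly_connected : Prop :=
  forall u w : V,
    connect [rel x y | ((x, y) \in A) || ((y, x) \in A)] u w.

Definition delta_out (u : V) : {set V * V} := [set a in A | a.1 == u].
Definition delta_in (u : V) : {set V * V} := [set a in A | a.2 == u].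

End Graph.

(* Arc quantities are total functions on [V * V] and on all times; every
   definition below only looks at arcs of [A] and at times in [0, tf], so the
   values elsewhere are irrelevant. *)
Section Network.
Variables (R : realType) (V : finType) (A : {set V * V}).

Definition mass_flow (area : V * V -> R) (rho : R) (v : V * V -> R -> R)
    (a : V * V) (t : R) : R :=
  area a * rho * v a t.

(* [temp a x t] is the temperature in arc [a] at position [x]. For
   [a \in delta_in A u] in a loopless graph, [a.1 != u], so the second branch
   applies; the value for arcs not incident to [u] is never used. *)
Definition end_temp (len : V * V -> R) (temp : V * V -> R -> R -> R)
    (a : V * V) (u : V) (t : R) : R :=
  if a.1 == u then temp a 0 t else temp a (len a) t.

Definition inflow_arcs (v : V * V -> R -> R) (u : V) (t : R) : {set V * V} :=
  [set a in delta_in A u | 0 <= v a t] :|: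
  [set a in delta_out A u | v a t <= 0].

Definition outflow_arcs (v : V * V -> R -> R) (u : V) (t : R) : {set V * V} :=
  [set a in delta_in A u | v a t < 0] :|:
  [set a in delta_out A u | 0 < v a t].

Variables (tf : R) (v q : V * V -> R -> R).

Definition mass_balance : Prop :=
  forall (u : V) (t : R), t \in `[0, tf] ->
    \sum_(a in delta_in A u) q a t = \sum_(a in delta_out A u) q a t.

Definition positive_inflow : Prop :=
  forall (u : V) (t : R), t \in `[0, tf] ->
    0 < \sum_(a in inflow_arcs v u t) `|q a t|.

(* [Tend a u t] is the temperature at the end of [a] located at [u], and
   [Tnode u t] the mixed temperature at [u]. *)
Variables (Tend : V * V -> V -> R -> R) (Tnode : V -> R -> R).

Definition mixing_equations : Prop :=
  (forall (u : V) (t : R), t \in `[0, tf] ->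
     Tnode u t = (\sum_(a in inflow_arcs v u t) `|q a t| * Tend a u t)
                 / (\sum_(a in inflow_arcs v u t) `|q a t|)) /\
  (forall (u : V) (a : V * V) (t : R), t \in `[0, tf] ->
     a \in outflow_arcs v u t -> Tnode u t = Tend a u t).

Definition energy_balance_and_propagation : Prop :=
  [/\ forall (u : V) (t : R), t \in `[0, tf] ->
        \sum_(a in delta_in A u) q a t * Tend a u t
        = \sum_(a in delta_out A u) q a t * Tend a u t,
      forall (u : V) (a : V * V) (t : R), t \in `[0, tf] ->
        a \in delta_out A u -> v a t * `|Tend a u t - Tnode u t| <= 0
    & forall (u : V) (a : V * V) (t : R), t \in `[0, tf] ->
        a \in delta_in A u -> 0 <= v a t * `|Tend a u t - Tnode u t|].

End Network.

(* Main.v *)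
(* At a fixed node and time, sign bookkeeping gives, for every weight f on arcs,
   sum_in q f - sum_out q f = sum_I |q| f - sum_O |q| f.  With f = 1, mass
   balance says that total inflow equals total outflow; with f the arc-end
   temperature, the energy balance says that sum_I |q| f = sum_O |q| f.
   Propagation forces f to equal the node temperature on O, so the energy
   balance becomes the mixing equation after dividing by the total inflow. *)
Require Import Defs.
From mathcomp Require Import all_boot all_order all_algebra.
From mathcomp Require Import reals ring.

Set Implicit Arguments.
Unset Strict Implicit.
Unset Printing Implicit Defensive.

Import Order.TTheory GRing.Theory Num.Theory.
Local Open Scope ring_scope.

(** An arc in both sets would start and end at [u], hence be a loop. Disjointness is what lets sums
    over [inflow_arcs] and [outflow_arcs] split into in-arcs and out-arcs. *)
Lemma delta_disjoint (V : finType) (A : {set V * V}) (u : V) :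
  loopless A -> [disjoint delta_in A u & delta_out A u].
Proof.
move=> noloop; apply/pred0P => a /=; rewrite !inE.
apply/negP => /andP[/andP[aA /eqP a2] /andP[_ /eqP a1]].
by have := noloop a aA; rewrite a1 a2 eqxx.
Qed.

Section FlowDirection.
Variables (R : realType) (V : finType) (A : {set V * V}).
Hypothesis A_loopless : loopless A.
Variables (area : V * V -> R) (rho : R) (v : V * V -> R -> R).
Hypothesis area_gt0 : forall a, a \in A -> 0 < area a.
Hypothesis rho_gt0 : 0 < rho.
Let q := mass_flow area rho v.

Lemma mass_flow_ge0 a t : a \in A -> (0 <= q a t) = (0 <= v a t).
Proof. by move=> aA; rewrite /q /mass_flow pmulr_rge0 // mulr_gt0 ?area_gt0. Qed.

Lemma mass_flow_le0 a t : a \in A -> (q a t <= 0) = (v a t <= 0).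
Proof. by move=> aA; rewrite /q /mass_flow pmulr_rle0 // mulr_gt0 ?area_gt0. Qed.

(** [|q|] equals [q] on in-arcs of the inflow set and out-arcs of the outflow set, and [- q] on the
    other two classes, so each of the four classes contributes the same signed term to both
    sides. *)
Lemma sum_inflow_sub_outflow (f : V * V -> R) u t :
  \sum_(a in inflow_arcs A v u t) `|q a t| * f a
    - \sum_(a in outflow_arcs A v u t) `|q a t| * f a
  = \sum_(a in delta_in A u) q a t * f a
    - \sum_(a in delta_out A u) q a t * f a.
Proof.
have disj (P Q : pred (V * V)) :
    [disjoint [set a in delta_in A u | P a] & [set a in delta_out A u | Q a]].
  apply: disjointWl (disjointWr _ (delta_disjoint u A_loopless));
    by apply/subsetP => a; rewrite inE => /andP[].
have ge0 a : a \in A -> 0 <= v a t -> `|q a t| = q a t.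
  by move=> aA v0; rewrite ger0_norm ?mass_flow_ge0.
have le0 a : a \in A -> v a t <= 0 -> `|q a t| = - q a t.
  by move=> aA v0; rewrite ler0_norm ?mass_flow_le0.
have splitU (P Q : pred (V * V)) (F : V * V -> R) :
    \sum_(a in [set a in delta_in A u | P a] :|: [set a in delta_out A u | Q a]) F a
    = \sum_(a in [set a in delta_in A u | P a]) F a
      + \sum_(a in [set a in delta_out A u | Q a]) F a.
  by rewrite -bigU ?disj //; apply: eq_bigl => a; rewrite in_setU.
rewrite !splitU.
(* Zero velocity counts as inflow for both kinds of arcs, so in-arcs split at [0 <= v] and out-arcs
   at [v <= 0]. *)
rewrite [in RHS](bigID (fun a => 0 <= v a t)) /=.
rewrite [X in _ = _ - X](bigID (fun a => v a t <= 0)) /=.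
have -> : \sum_(a in [set a in delta_in A u | 0 <= v a t]) `|q a t| * f a
    = \sum_(a in delta_in A u | 0 <= v a t) q a t * f a.
  apply: eq_big => [a|a]; rewrite !inE // => /andP[/andP[aA _] va].
  by rewrite ge0.
have -> : \sum_(a in [set a in delta_out A u | v a t <= 0]) `|q a t| * f a
    = - \sum_(a in delta_out A u | v a t <= 0) q a t * f a.
  rewrite -sumrN; apply: eq_big => [a|a]; rewrite !inE // => /andP[/andP[aA _] va].
  by rewrite le0 // mulNr.
have -> : \sum_(a in [set a in delta_in A u | v a t < 0]) `|q a t| * f a
    = - \sum_(a in delta_in A u | ~~ (0 <= v a t)) q a t * f a.
  rewrite -sumrN; apply: eq_big => [a|a]; rewrite !inE -?ltNge //.
  by move=> /andP[/andP[aA _] /ltW va]; rewrite le0 // mulNr.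
have -> : \sum_(a in [set a in delta_out A u | 0 < v a t]) `|q a t| * f a
    = \sum_(a in delta_out A u | ~~ (v a t <= 0)) q a t * f a.
  apply: eq_big => [a|a]; rewrite !inE -?ltNge //.
  by move=> /andP[/andP[aA _] /ltW va]; rewrite ge0.
ring.
Qed.

(** Each equation says that one side of [sum_inflow_sub_outflow] vanishes. *)
Lemma balance_inflow_outflow (f : V * V -> R) u t :
  \sum_(a in delta_in A u) q a t * f a = \sum_(a in delta_out A u) q a t * f a
  <-> \sum_(a in inflow_arcs A v u t) `|q a t| * f a
      = \sum_(a in outflow_arcs A v u t) `|q a t| * f a.
Proof.
have h := sum_inflow_sub_outflow f u t.
by split=> e; apply/eqP; rewrite -subr_eq0; [rewrite h|rewrite -h]; rewrite e subrr.
Qed.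

(** The sign of [v] alone gives the inequality on every arc at [u] of inflow type; on outflow arcs
    the sign is the wrong one, so the inequality can hold only if [f a = x]. *)
Lemma outflow_eq_propagation (f : V * V -> R) x u t :
  (forall a, a \in outflow_arcs A v u t -> x = f a) <->
  (forall a, a \in delta_out A u -> v a t * `|f a - x| <= 0) /\
  (forall a, a \in delta_in A u -> 0 <= v a t * `|f a - x|).
Proof.
split=> [xf|[out_le0 in_ge0] a].
  split=> a au.
    have [va|va] := lerP (v a t) 0; first by rewrite mulr_le0_ge0.
    by rewrite -xf ?subrr ?normr0 ?mulr0 // inE [_ \in [set a in _ | 0 < _]]inE au va orbT.
  have [va|va] := lerP 0 (v a t); first by rewrite mulr_ge0.
  by rewrite -xf ?subrr ?normr0 ?mulr0 // inE [_ \in [set a in _ | _ < 0]]inE au va.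
(* On outflow arcs [v] is strictly signed, so it cancels and leaves [|f a - x| <= 0]. *)
rewrite in_setU !in_set => /orP[] /andP[ain va].
  have := in_ge0 a; rewrite inE => /(_ ain).
  by rewrite nmulr_rge0 // normr_le0 subr_eq0 => /eqP.
have := out_le0 a; rewrite inE => /(_ ain).
by rewrite pmulr_rle0 // normr_le0 subr_eq0 => /eqP.
Qed.

(** Propagation enters as a hypothesis because both systems contain it, in the two forms related by
    [outflow_eq_propagation]. *)
Lemma mixing_iff_energy_balance (f : V * V -> R) x u t :
  \sum_(a in delta_in A u) q a t = \sum_(a in delta_out A u) q a t ->
  0 < \sum_(a in inflow_arcs A v u t) `|q a t| ->
  (forall a, a \in outflow_arcs A v u t -> x = f a) ->
  x = (\sum_(a in inflow_arcs A v u t) `|q a t| * f a)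
      / (\sum_(a in inflow_arcs A v u t) `|q a t|) <->
  \sum_(a in delta_in A u) q a t * f a = \sum_(a in delta_out A u) q a t * f a.
Proof.
move=> bal pos xf; rewrite balance_inflow_outflow.
have inout : \sum_(a in inflow_arcs A v u t) `|q a t|
    = \sum_(a in outflow_arcs A v u t) `|q a t|.
  have mul1 (S : {set V * V}) (g : V * V -> R) :
      \sum_(a in S) g a * 1 = \sum_(a in S) g a.
    by apply: eq_bigr => a _; rewrite mulr1.
  by have := (balance_inflow_outflow (fun=> 1) u t).1; rewrite !mul1; apply.
(* On outflow arcs [f] is the constant [x], which leaves the sum; [inout] turns the remaining total
   outflow into the denominator of the mixing equation. *)
have -> : \sum_(a in outflow_arcs A v u t) `|q a t| * f a
    = x * \sum_(a in inflow_arcs A v u t) `|q a t|.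
  by rewrite inout mulr_sumr; apply: eq_bigr => a /xf <-; rewrite mulrC.
split=> [->|->]; first by rewrite divfK ?gt_eqF.
by rewrite mulfK ?gt_eqF.
Qed.

End FlowDirection.

Theorem theorem1 (R : realType) (V : finType) (A : {set V * V})
  (A_loopless : loopless A) (A_connected : weakly_connected A)
  (tf : R) (tf_gt0 : 0 < tf)
  (area : V * V -> R) (area_gt0 : forall a, a \in A -> 0 < area a)
  (rho : R) (rho_gt0 : 0 < rho)
  (v : V * V -> R -> R)
  (len : V * V -> R) (temp : V * V -> R -> R -> R)
  (Tnode : V -> R -> R)
  (q_balance : mass_balance A tf (mass_flow area rho v))
  (q_inflow : positive_inflow A tf v (mass_flow area rho v)) :
  mixing_equations A tf v (mass_flow area rho v) (end_temp len temp) Tnode <->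
  energy_balance_and_propagation A tf v (mass_flow area rho v)
    (end_temp len temp) Tnode.
Proof.
split=> [[mix out_eq]|[energy out_le0 in_ge0]].
  have prop u t (tT : t \in `[0, tf]) :=
    (outflow_eq_propagation A v (end_temp len temp ^~ u ^~ t) (Tnode u t) u t).1
      (fun a => out_eq u a t tT).
  split=> [u t tT|u a t tT|u a t tT].
  - apply/(mixing_iff_energy_balance A_loopless area_gt0 rho_gt0
      (q_balance u t tT) (q_inflow u t tT)); last exact: mix.
    by move=> a; apply: out_eq.
  - exact: (prop u t tT).1.
  - exact: (prop u t tT).2.
(* The outflow equations are recovered first, since passing from energy balance to mixing relies on
   them. *)
have out_eq u a t : t \in `[0, tf] -> a \in outflow_arcs A v u t ->
    Tnode u t = end_temp len temp a u t.
  move=> tT; apply: (outflow_eq_propagation A v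
    (end_temp len temp ^~ u ^~ t) (Tnode u t) u t).2.
  by split=> b; [apply: out_le0|apply: in_ge0].
split=> // u t tT.
apply/(mixing_iff_energy_balance A_loopless area_gt0 rho_gt0
  (q_balance u t tT) (q_inflow u t tT)); last exact: energy.
by move=> a; apply: out_eq.
Qed.
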